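(* Let $z(\zeta)=D\zeta+r$ be an AAR solution of the uncertain LCP $$0\le z(\zeta)\perp M(\zeta)z(\zeta)+q\ge 0\quad\text{for all }\zeta\in\mathcal{U},$$ and let $J=\{j\in[n]: r_j>0\}$. Then \begin{align*} M^0_Jr_J+q_J&=0,\\ M^i_Jr_J+M^0_JD_{J,i}&=0\quad\text{for all } i\in[k],\\ M^i_JD_{J,i}&=0\quad\text{for all } i\in[k],\\ M^i_JD_{J,j}+M^j_JD_{J,i}&=0\quad\text{for all } i,j\in[k],\ i\ne j. \end{align*}
   Context: Notation: $[n]=\{1,\dots,n\}$. For a matrix $A$ and index sets $I,J$, $A_{I,J}$ is the submatrix with rows in $I$ and columns in $J$, $A_I=A_{I,I}$ (so $M^i_J=(M^i)_{J,J}$), and $A_{I,\cdot}$ consists of the rows in $I$; $D_{J,i}$ is the subvector, indexed by $J$, of the $i$-th column of $D$; $b_I$ is the subvector of $b$ indexed by $I$. Vector inequalities are componentwise, and $0\le a\perp b\ge 0$ means $a\ge0$, $b\ge0$, $a^\top b=0$. Data: matrices $M^0,M^1,\dots,M^k\in\mathbb{R}^{n\times n}$, $q\in\mathbb{R}^n$, $h\in\{0,\dots,n\}$, the uncertainty set $\mathcal{U}=[-1,1]^k$, and $M(\zeta)=M^0+\sum_{i=1}^k\zeta_iM^i$ for $\zeta\in\mathcal{U}$. An affinely adjustable robust (AAR) solution of this uncertain LCP is an affine function $z(\zeta)=D\zeta+r$ with $D\in\mathbb{R}^{n\times k}$, $r\in\mathbb{R}^n$ and $D_{[h],\cdot}=0$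 (the first $h$ rows of $D$ are zero), such that $0\le z(\zeta)\perp M(\zeta)z(\zeta)+q\ge0$ for all $\zeta\in\mathcal{U}$. *)

(* Defs.v *)
From mathcomp Require Import all_boot all_order all_algebra.
From mathcomp Require Import reals.

Set Implicit Arguments.
Unset Strict Implicit.
Unset Printing Implicit Defensive.

Import Order.TTheory GRing.Theory Num.Theory.
Local Open Scope ring_scope.

(* A_{I,J}: the entries of I and J are listed in increasing order by enum_val. *)
Definition submx (R : Type) (m n : nat) (I : {set 'I_m}) (J : {set 'I_n})
  (A : 'M[R]_(m, n)) : 'M[R]_(#|I|, #|J|) := mxsub enum_val enum_val A.

Definition princ_submx (R : Type) (n : nat) (J : {set 'I_n}) (A : 'M[R]_n) :
  'M[R]_#|J| := submx J J A.

(* On column vectors, this is the subvector b_I. *)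
Definition subrows (R : Type) (m n : nat) (I : {set 'I_m})
  (A : 'M[R]_(m, n)) : 'M[R]_(#|I|, n) := rowsub enum_val A.

(* The set [h] = {1, ..., h}, shifted to the 0-based indices of 'I_n. *)
Definition initial_set (n h : nat) : {set 'I_n} := [set i : 'I_n | (i < h)%N].

Definition nonneg_vec (R : numDomainType) (n : nat) (a : 'cV[R]_n) : Prop :=
  forall i, 0 <= a i 0.

Definition complementary (R : numDomainType) (n : nat) (a b : 'cV[R]_n) : Prop :=
  [/\ nonneg_vec a, nonneg_vec b & a^T *m b = 0].

Definition unc_box (R : numDomainType) (k : nat) (zeta : 'cV[R]_k) : Prop :=
  forall i, -1 <= zeta i 0 <= 1.

Definition unc_mx (R : nzRingType) (n k : nat) (M0 : 'M[R]_n)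
  (M : 'I_k -> 'M[R]_n) (zeta : 'cV[R]_k) : 'M[R]_n :=
  M0 + \sum_(i < k) zeta i 0 *: M i.

Definition affine_fun (R : nzRingType) (n k : nat) (D : 'M[R]_(n, k))
  (r : 'cV[R]_n) (zeta : 'cV[R]_k) : 'cV[R]_n := D *m zeta + r.

(* The affine function zeta |-> D zeta + r is an affinely adjustable robust
   solution whose first h components are not adjustable. *)
Definition AAR_solution (R : numDomainType) (n k : nat) (M0 : 'M[R]_n)
  (M : 'I_k -> 'M[R]_n) (q : 'cV[R]_n) (h : nat)
  (D : 'M[R]_(n, k)) (r : 'cV[R]_n) : Prop :=
  subrows (initial_set n h) D = 0 /\
  forall zeta : 'cV[R]_k, unc_box zeta ->
    complementary (affine_fun D r zeta)
                  (unc_mx M0 M zeta *m affine_fun D r zeta + q).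

(* Main.v *)
(** Off [J] the component [z_j] is nonnegative on the box and vanishes at its
    centre, so it vanishes identically, and products with [z] only see the
    columns in [J].  For [j] in [J], [z_j (zeta)] is the mean of
    [z_j (2 zeta) >= 0] and [z_j 0 > 0], so [z_j] is positive on the half box;
    by complementarity the quadratic polynomial [(M(zeta) z(zeta) + q)_j]
    vanishes there, and so do its coefficients. *)
Require Import Defs.
From mathcomp Require Import all_boot all_order all_algebra.
From mathcomp Require Import reals.
From mathcomp Require Import ring lra.

Set Implicit Arguments.
Unset Strict Implicit.
Unset Printing Implicit Defensive.

Import Order.TTheory GRing.Theory Num.Theory.
Local Open Scope ring_scope.

(** The columns of [A] outside [J] meet only zero rows of [B], so dropping them changes nothing.
    This trades block products for entries of full products. *)
Lemma submx_mul_supported (R : pzSemiRingType) (m n p : nat) (I : {set 'I_m})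
  (J : {set 'I_n}) (A : 'M[R]_(m, n)) (B : 'M[R]_(n, p)) :
  (forall j, j \notin J -> forall l, B j l = 0) ->
  Defs.submx I J A *m subrows J B = subrows I (A *m B).
Proof.
move=> suppB; apply/matrixP=> i l; rewrite !mxE.
rewrite (bigID (mem J)) /= [X in _ + X]big1 ?addr0 => [|j jJ]; last first.
  by rewrite suppB ?mulr0.
by rewrite [RHS]big_enum_val; apply: eq_bigr => j _; rewrite !mxE.
Qed.

Lemma subrowsD (R : nmodType) (m n : nat) (I : {set 'I_m}) (A B : 'M[R]_(m, n)) :
  subrows I (A + B) = subrows I A + subrows I B.
Proof. by apply/matrixP=> i j; rewrite !mxE. Qed.

Lemma subrows_eq0 (R : nmodType) (m : nat) (I : {set 'I_m}) (v : 'cV[R]_m) :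
  (forall i, i \in I -> v i 0 = 0) -> subrows I v = 0.
Proof.
by move=> v0; apply/matrixP=> i j; rewrite !mxE ord1 v0 ?enum_valP.
Qed.

(** A sum of nonnegative terms that is zero has only zero terms. *)
Lemma complementary_entry (R : numDomainType) (n : nat) (a b : 'cV[R]_n) :
  complementary a b -> forall i, a i 0 * b i 0 = 0.
Proof.
move=> [a0 b0 ab] i.
have := congr1 (fun A : 'M_1 => A 0 0) ab; rewrite !mxE => /psumr_eq0P-/(_ _ i).
by rewrite mxE; apply=> // l _; rewrite mxE mulr_ge0.
Qed.

(** Each coefficient of a quadratic polynomial in [zeta] involves at most two coordinates, so these
    points suffice. The case [i = l] is allowed. *)
Definition two_point (R : nzRingType) (k : nat) (i l : 'I_k) (s t : R) :
  'cV[R]_k := s *: delta_mx i 0 + t *: delta_mx l 0.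

Lemma unc_mx_two_point (R : nzRingType) (n k : nat) (M0 : 'M[R]_n)
  (M : 'I_k -> 'M[R]_n) (i l : 'I_k) (s t : R) :
  unc_mx M0 M (two_point i l s t) = M0 + (s *: M i + t *: M l).
Proof.
(* Treating the two unit vectors separately avoids a case split on [i = l]. *)
have pick (c : R) m : \sum_(x < k) (c *: delta_mx m 0 : 'cV_k) x 0 *: M x = c *: M m.
  rewrite (bigD1 m) //= big1 ?addr0 => [|x /negPf xm]; rewrite !mxE ?eqxx ?mulr1 //.
  by rewrite xm mulr0 scale0r.
rewrite /unc_mx -!pick -big_split /=; congr (_ + _).
by apply: eq_bigr => x _; rewrite mxE scalerDl.
Qed.

Lemma affine_fun_two_point (R : comNzRingType) (n k : nat) (D : 'M[R]_(n, k))
  (r : 'cV[R]_n) (i l : 'I_k) (s t : R) :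
  affine_fun D r (two_point i l s t) = s *: col i D + t *: col l D + r.
Proof. by rewrite /affine_fun mulmxDr -!scalemxAr -!colE. Qed.

(** The bound is on the sum, not the maximum, because [s] and [t] add up in one coordinate when
    [i = l]. *)
Lemma unc_box_two_point (R : realDomainType) (k : nat) (i l : 'I_k) (s t : R) :
  `|s| + `|t| <= 1 -> unc_box (two_point i l s t).
Proof.
move=> st x; rewrite -ler_norml; apply: le_trans st.
rewrite !mxE !eqxx !andbT; apply: le_trans (ler_normD _ _) _.
by rewrite !normrM; apply: lerD; case: (x == _);
  rewrite ?normr1 ?normr0 ?mulr1 ?mulr0.
Qed.

Section AAR.
Variables (R : realFieldType) (n k : nat) (M0 : 'M[R]_n) (M : 'I_k -> 'M[R]_n).
Variables (q : 'cV[R]_n) (h : nat) (D : 'M[R]_(n, k)) (r : 'cV[R]_n).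
Hypothesis sol : AAR_solution M0 M q h D r.

Lemma AAR_two_point_ge0 (i l : 'I_k) (s t : R) (j : 'I_n) :
  `|s| + `|t| <= 1 -> 0 <= s * D j i + t * D j l + r j 0.
Proof.
move=> /(unc_box_two_point i l)/sol.2[+ _ _] => /(_ j).
by rewrite affine_fun_two_point !mxE.
Qed.

Lemma AAR_center_ge0 (j : 'I_n) : 0 <= r j 0.
Proof.
have /sol.2[+ _ _] : unc_box (0 : 'cV[R]_k) by move=> x; rewrite mxE; lra.
by move=> /(_ j); rewrite /affine_fun mulmx0 add0r.
Qed.

Lemma AAR_rows_supported (j : 'I_n) :
  ~~ (0 < r j 0) -> r j 0 = 0 /\ forall i, D j i = 0.
Proof.
rewrite lt_def AAR_center_ge0 andbT negbK => /eqP r0; split=> // i.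
(* At the points plus and minus the [i]-th unit vector, [z_j] equals [D j i] and [- D j i], both
   nonnegative. *)
have := @AAR_two_point_ge0 i i 1 0 j; have := @AAR_two_point_ge0 i i (-1) 0 j.
by rewrite normrN normr1 normr0 r0 addr0 => /(_ (lexx _)) ? /(_ (lexx _)) ?; lra.
Qed.

Lemma AAR_center_slack0 (j : 'I_n) :
  0 < r j 0 -> (M0 *m r + q) j 0 = 0.
Proof.
have /sol.2/complementary_entry/(_ j) : unc_box (0 : 'cV[R]_k).
  by move=> x; rewrite mxE; lra.
rewrite /affine_fun mulmx0 add0r /unc_mx big1 ?addr0 => [|x _].
  by move=> /eqP; rewrite mulf_eq0 => /orP[/eqP->|/eqP]//; rewrite ltxx.
by rewrite mxE scale0r.
Qed.

(** The left side is the [j]-th slack at [two_point i l s t], sorted by monomials in [s] and [t], so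
    that evaluations isolate its coefficients. *)
Lemma AAR_two_point_slack0 (i l : 'I_k) (s t : R) (j : 'I_n) :
  0 < r j 0 -> `|s| + `|t| <= 1 / 2 ->
  (M0 *m r + q) j 0
  + s * (M i *m r + M0 *m col i D) j 0
  + t * (M l *m r + M0 *m col l D) j 0
  + s ^+ 2 * (M i *m col i D) j 0
  + s * t * (M i *m col l D + M l *m col i D) j 0
  + t ^+ 2 * (M l *m col l D) j 0 = 0.
Proof.
move=> rj st.
have z_gt0 : 0 < s * D j i + t * D j l + r j 0.
  have := @AAR_two_point_ge0 i l (2 * s) (2 * t) j.
  by rewrite !normrM normr_nat => H; have := H ltac:(lra); lra.
have /(unc_box_two_point i l)/sol.2/complementary_entry/(_ j) : `|s| + `|t| <= 1.
  by lra.
move=> /eqP; rewrite affine_fun_two_point unc_mx_two_point mulf_eq0.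
case/orP=> /eqP; first by rewrite !mxE => z0; rewrite z0 ltxx in z_gt0.
rewrite !(mulmxDl, mulmxDr) -!(scalemxAl, scalemxAr).
have addE (A B : 'cV[R]_n) : (A + B) j 0 = A j 0 + B j 0 by rewrite mxE.
have scaleE c (A : 'cV[R]_n) : (c *: A) j 0 = c * A j 0 by rewrite mxE.
by rewrite !(addE, scaleE) => slack0; rewrite -[RHS]slack0; ring.
Qed.

(** The values at [(1/4, 0)] and [(-1/4, 0)] separate the linear from the square coefficient; then
    [(1/4, 1/4)] leaves only the mixed one. The value [1/4] keeps [|s| + |t|] within [1/2]. *)
Lemma AAR_coefs0 (i l : 'I_k) (j : 'I_n) : 0 < r j 0 ->
  [/\ (M i *m r + M0 *m col i D) j 0 = 0,
      (M i *m col i D) j 0 = 0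
    & (M i *m col l D + M l *m col i D) j 0 = 0].
Proof.
move=> rj; have c0 := AAR_center_slack0 rj.
have nq : `|1 / 4 : R| = 1 / 4 by rewrite ger0_norm; lra.
have nNq : `|- (1 / 4) : R| = 1 / 4 by rewrite normrN.
have linear_square x : (M x *m r + M0 *m col x D) j 0 = 0
    /\ (M x *m col x D) j 0 = 0.
  have := @AAR_two_point_slack0 x x (1 / 4) 0 j rj.
  have := @AAR_two_point_slack0 x x (- (1 / 4)) 0 j rj.
  rewrite nq nNq normr0 c0 => Hm Hp.
  have := Hm ltac:(lra); have := Hp ltac:(lra).
  move: (_ j 0) (_ j 0) (_ j 0) => a b c; split; lra.
have [ai bi] := linear_square i; have [al bl] := linear_square l.
split=> //; have := @AAR_two_point_slack0 i l (1 / 4) (1 / 4) j rj.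
rewrite nq c0 ai bi al bl => H; have := H ltac:(lra).
move: (_ j 0) => a; lra.
Qed.

End AAR.

Theorem theorem5 (R : realType) (n k : nat) (M0 : 'M[R]_n)
  (M : 'I_k -> 'M[R]_n) (q : 'cV[R]_n) (h : nat) (hn : (h <= n)%N)
  (D : 'M[R]_(n, k)) (r : 'cV[R]_n) (sol : AAR_solution M0 M q h D r) :
  let J := [set j : 'I_n | 0 < r j 0] in
  [/\ princ_submx J M0 *m subrows J r + subrows J q = 0,
      forall i : 'I_k,
        princ_submx J (M i) *m subrows J r
        + princ_submx J M0 *m subrows J (col i D) = 0,
      forall i : 'I_k, princ_submx J (M i) *m subrows J (col i D) = 0
    & forall i j : 'I_k, i != j ->
        princ_submx J (M i) *m subrows J (col j D)
        + princ_submx J (M j) *m subrows J (col i D) = 0].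
Proof.
move=> J.
have suppr j : j \notin J -> forall l, r j l = 0.
  by rewrite inE => /(AAR_rows_supported sol)[r0 _] l; rewrite ord1.
have suppD i j : j \notin J -> forall l, col i D j l = 0.
  by rewrite inE => /(AAR_rows_supported sol)[_ D0] l; rewrite mxE.
have mulr A := submx_mul_supported J A suppr.
have mulD i A := submx_mul_supported J A (suppD i).
(* Each block identity becomes the vanishing on [J] of one full vector. *)
split=> [|i|i|i l _]; rewrite /princ_submx ?mulr ?mulD -?subrowsD;
  apply: subrows_eq0 => j; rewrite inE => rj.
- exact: AAR_center_slack0 sol _ rj.
- by have [] := AAR_coefs0 sol i i rj.
- by have [] := AAR_coefs0 sol i i rj.
- by have [] := AAR_coefs0 sol i l rj.
Qed.
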